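(* For all integers $n\ge5$ and $s$ with $2\le s\le\lfloor\frac{n-1}{2}\rfloor$, $$\mathrm{diam}(C_n(1,s))\le\min\left(\max\left\{\left\lfloor\frac{n}{s}\right\rfloor+1,\; n-\left\lfloor\frac{n}{s}\right\rfloor s-2,\; \left(\left\lfloor\frac{n}{s}\right\rfloor+1\right)s-n-1\right\},\; \left\lfloor\frac{n+2}{4}\right\rfloor,\; \left\lfloor\frac{\lfloor n/2\rfloor}{s}\right\rfloor+\left\lceil\frac{s}{2}\right\rceil\right).$$
   Context: For integers $n\ge5$ and $2\le s\le\lfloor\frac{n-1}{2}\rfloor$, the circulant graph $C_n(1,s)$ is the graph with vertex set $\{0,1,\ldots,n-1\}$ in which two distinct vertices $i,j$ are adjacent if and only if $|i-j|_n\in\{1,s\}$, where $|x|_n=\min(|x|,n-|x|)$. The distance between two vertices is the length (number of edges) of a shortest path joining them, and $\mathrm{diam}$ is the maximum distance over all pairs of vertices. *)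

(* Defs.v *)
From mathcomp Require Import all_boot all_order all_algebra.

Set Implicit Arguments.
Unset Strict Implicit.
Unset Printing Implicit Defensive.

Section Distance.

Variables (T : finType) (e : rel T).

(* The sequence x :: p is a path (no repeated vertex) from x to y; its length,
   i.e. its number of edges, is size p. *)
Definition joins (x y : T) (p : seq T) : bool :=
  [&& path e x p, uniq (x :: p) & last x p == y].

Definition has_path_of_length (x y : T) (k : nat) : bool :=
  [exists p : k.-tuple T, joins x y p].

(* A path has fewer than #|T| edges, so bounding the search loses nothing; two
   vertices joined by no path get the value #|T|, larger than any distance. *)
Definition gdist (x y : T) : nat :=
  find (has_path_of_length x y) (iota 0 #|T|).

Definition diam : nat := \max_(x : T) \max_(y : T) gdist x y.

Lemma joins_size x y p : joins x y p -> size p < #|T|.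
Proof. by case/and3P=> _ Up _; have := max_card (mem (x :: p)); rewrite (card_uniqP Up). Qed.

Lemma has_path_of_lengthP x y k :
  reflect (exists2 p, joins x y p & size p = k) (has_path_of_length x y k).
Proof.
apply: (iffP existsP) => [[p jp]|[p jp <-]]; first by exists p; rewrite ?size_tuple.
by exists (in_tuple p).
Qed.

Lemma gdist_le x y p : joins x y p -> gdist x y <= size p.
Proof.
move=> jp; rewrite leqNgt; apply/negP => /(before_find 0).
rewrite nth_iota ?(joins_size jp) // add0n => /negbT/negP; apply.
by apply/has_path_of_lengthP; exists p.
Qed.

Lemma gdist_attained x y :
  connect e x y -> exists2 p, joins x y p & size p = gdist x y.
Proof.
case/connectP=> p0 /shortenP[p ep Up _] yE.
have jp : joins x y p by rewrite /joins ep Up yE eqxx.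
apply/has_path_of_lengthP; have lt := leq_ltn_trans (gdist_le jp) (joins_size jp).
have := @nth_find _ 0 (has_path_of_length x y) (iota 0 #|T|).
rewrite -/(gdist x y) nth_iota // add0n; apply.
by rewrite has_find size_iota.
Qed.

End Distance.

(* |x|_n = min(|x|, n - |x|), used only for |x| < n, where the natural number
   subtraction does not truncate. *)
Definition cnorm (n : nat) (x : int) : nat := minn `|x| (n - `|x|).

Definition circulant (n s : nat) : rel 'I_n :=
  fun i j => (i != j) && (cnorm n (i%:Z - j%:Z)%R \in [:: 1; s]).
Arguments circulant : clear implicits.

(* Main.v *)
Require Import Defs.
From mathcomp Require Import all_boot all_order all_algebra.
From mathcomp Require Import zify ring.

(** In a circulant graph a walk is determined by its start and by the net
    numbers a and b of steps of length 1 and s: it moves by a + b s modulo n.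
    So the distance between two vertices whose difference is k is at most
    |a| + |b| whenever k = a + b s + c n for some integer c
    ([represents_gdist]), and by the symmetry k -> -k only 0 <= k <= n/2 has to
    be considered ([diam_represents]).  Everything then reduces to picking
    short vectors (a, b) in a coset of the lattice of all (a, b) such that n
    divides a + b s.

    Write n = l s + r and k = y s + x by Euclidean division.  The lattice
    contains (s, -1) and (r, l), and the vector (x, y) represents k.

    - Rounding x up or down to a multiple of s gives (x, y) and (x - s, y + 1);
      the better one has length at most floor(floor(n/2)/s) + ceil(s/2)
      ([represents_nearest]).
    - Subtracting (r, l) gives (x - r, y - l).  If x <= r, then (x, y) and
      (x - r, y - l) have total length r + l; if x > r, then (x - s, y + 1) and
      (x - r, y - l) have total length s - r + l + 1.  The shorter vector has at
      most half of that length ([represents_corners]).  Comparing r with l + 2,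
      and s - r with l + 2, turns these halves into the three-term maximum.
    - The same halves are at most floor((n + 2)/4), essentially because
      (l - 2)(s - 2) >= 0 ([corners_le_quarter]).  The exceptions are the
      families s = 2 and n = 2 s + 1 and three small pairs (n, s), where short
      vectors are explicit ([represents_quarter]). *)

Set Implicit Arguments.
Unset Strict Implicit.
Unset Printing Implicit Defensive.

Import Order.TTheory GRing.Theory Num.Theory.

Section Walks.

Variables (T : finType) (e : rel T).

Definition walk (x y : T) (m : nat) : Prop :=
  exists2 p, path e x p & last x p = y /\ size p <= m.

Lemma walk_cat x y z m1 m2 :
  walk x y m1 -> walk y z m2 -> walk x z (m1 + m2).
Proof.
case=> p xp [<- sp] [q yq [<- sq]]; exists (p ++ q); first by rewrite cat_path xp.
by rewrite last_cat size_cat leq_add.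
Qed.

(** Unlike the paths in the definition of the distance, walks may repeat
    vertices; deleting the loops of a walk only shortens it. *)
Lemma gdist_walk x y m : walk x y m -> gdist e x y <= m.
Proof.
case=> p xp [lp sp]; apply: leq_trans sp; move: lp.
case/shortenP: xp => q xq uq qp lq; apply: leq_trans (uniq_leq_size _ qp).
  by apply: gdist_le; rewrite /joins xq uq lq eqxx.
by case/andP: uq.
Qed.

End Walks.

Section Circulant.

Variables n s : nat.
Hypotheses (s_ge2 : 2 <= s) (s_lt : s <= (n - 1) %/ 2).

Local Notation e := (circulant n s).

(** The congruence j = i + d modulo n is spelled out with a quotient c, so
    that composing displacements only adds quotients. *)
Definition walkable (d : int) (m : nat) : Prop :=
  forall i j : 'I_n, forall c : int,
    (j%:Z = i%:Z + d + c * n%:Z)%R -> walk e i j m.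

Lemma walkable0 : walkable 0 0.
Proof.
move=> i j c E; exists [::] => //; split=> //; apply: val_inj => /=.
have := ltn_ord i; have := ltn_ord j.
(* Two residues in [0, n[ that differ by a multiple of n are equal. *)
have [c0|[c0|c0]] : (c = 0 \/ c <= -1 \/ 1 <= c)%R by lia.
- by rewrite c0 in E; lia.
- by nia.
- by nia.
Qed.

Lemma walkable1 d : `|d|%N \in [:: 1; s] -> walkable d 1.
Proof.
rewrite !inE => hd i j c E; exists [:: j] => //=; rewrite andbT /circulant /cnorm !inE.
have := ltn_ord i; have := ltn_ord j => hj hi.
(* As |d| < n / 2, at most one turn around the cycle is needed. *)
have {E} : (c = 0 \/ c = -1 \/ c = 1)%R /\ (j%:Z = i%:Z + d + c * n%:Z)%R.
  by split=> //; nia.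
rewrite -val_eqE /=; case=> -[->|[->|->]] E; apply/andP; split; lia.
Qed.

Lemma walkableD d1 d2 m1 m2 :
  walkable d1 m1 -> walkable d2 m2 -> walkable (d1 + d2)%R (m1 + m2).
Proof.
move=> h1 h2 i j c E; have n_gt0 : 0 < n by have := ltn_ord i; lia.
have lt_k : (`|(i%:Z + d1) %% n|)%Z < n by lia.
have := divz_eq (i%:Z + d1) n; set q := (_ %/ _)%Z => Ek.
apply: (@walk_cat _ _ _ (Ordinal lt_k)).
  by apply: (h1 _ _ (- q)%R) => /=; lia.
by apply: (h2 _ _ (c + q)%R) => /=; lia.
Qed.

Lemma walkableM (b d : int) : `|d|%N \in [:: 1; s] -> walkable (b * d)%R `|b|.
Proof.
move=> hd; wlog [k ->] : b d hd / exists k : nat, b = k.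
  move=> W; have [b_ge0|b_lt0] : (0 <= b \/ b <= 0)%R by lia.
    by apply: W => //; exists `|b|%N; lia.
  rewrite -mulrNN -abszN; apply: W; first by rewrite abszN.
  by exists `|b|%N; lia.
elim: k => [|k IH]; first by rewrite mul0r; apply: walkable0.
rewrite -addn1 PoszD mulrDl mul1r absz_nat; apply: walkableD => //; exact: walkable1.
Qed.

(** The l1 norm of (a, b) bounds the number of edges spent on moving by k. *)
Definition represents (m : nat) (k : int) : Prop :=
  exists a b c : int, `|a| + `|b| <= m /\ (k = a + b * s%:Z + c * n%:Z)%R.

Lemma representsN m k : represents m k -> represents m (- k)%R.
Proof.
move=> [a [b [c [le E]]]]; exists (- a)%R, (- b)%R, (- c)%R.
by rewrite !abszN E; split=> //; ring.
Qed.

Lemma represents_le m1 m2 k : m1 <= m2 -> represents m1 k -> represents m2 k.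
Proof.
move=> le12 [a [b [c [le E]]]]; exists a, b, c; split=> //; exact: leq_trans le12.
Qed.

Lemma represents_gdist m (i j : 'I_n) :
  represents m (j%:Z - i%:Z)%R -> gdist e i j <= m.
Proof.
case=> a [b [c [le E]]]; apply: leq_trans le; apply: gdist_walk.
have h1 : walkable (a * 1)%R `|a| by apply: walkableM; rewrite !inE.
have h2 : walkable (b * s%:Z)%R `|b| by apply: walkableM; rewrite !inE absz_nat eqxx orbT.
by apply: (walkableD h1 h2 (c := c)); rewrite mulr1; lia.
Qed.

Lemma diam_represents m :
  (forall k : nat, k <= n %/ 2 -> represents m k) -> diam e <= m.
Proof.
move=> H; apply/bigmax_leqP => i _; apply/bigmax_leqP => j _.
apply: represents_gdist.
have hi := ltn_ord i; have hj := ltn_ord j.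
wlog le_ij : i j hi hj / i <= j.
  move=> W; case: (leqP i j) => [|/ltnW] le; first exact: W.
  by rewrite -opprB; apply: representsN; apply: W.
have [le|gt] := leqP (j - i) (n %/ 2).
  by have := H _ le; congr represents; lia.
(* Go round the cycle the other way, moving by n - (j - i). *)
have le : n - (j - i) <= n %/ 2 by lia.
have [a [b [c [lem E]]]] := representsN (H _ le).
by exists a, b, (c + 1)%R; split=> //; lia.
Qed.

(** Reach the nearest multiple of s below or above k by steps of length 1. *)
Lemma represents_nearest k :
  k <= n %/ 2 -> represents (n %/ 2 %/ s + uphalf s) k.
Proof.
move=> le_k; have le_q : k %/ s <= n %/ 2 %/ s by exact: leq_div2r.
have := divn_eq k s; have : k %% s < s by rewrite ltn_mod; lia.
set y := k %/ s in le_q *; set x := k %% s => lt_x E.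
have [le|gt] := leqP x (uphalf s).
  by exists x, y, 0%R; split; lia.
by exists (x%:Z - s%:Z)%R, (y%:Z + 1)%R, 0%R; split; lia.
Qed.

(** The two vectors tried in each case have a fixed total length, because they
    are differences of (x, y) with two lattice points that are opposite corners
    of a box containing (x, y): the corners (0, 0) and (r, l) when x <= r, and
    (s, -1) and (r, l) when r < x. *)
Lemma represents_corners k : k < n ->
  represents (maxn ((n %% s + n %/ s) %/ 2) ((s - n %% s + n %/ s).+1 %/ 2)) k.
Proof.
move=> lt_k; have s_gt0 : 0 < s by lia.
have le_y : k %/ s <= n %/ s by apply: leq_div2r; exact: ltnW.
have := divn_eq k s; have := divn_eq n s.
have := ltn_pmod n s_gt0; have := ltn_pmod k s_gt0.
set y := k %/ s in le_y *; set x := k %% s; set l := n %/ s in le_y *; set r := n %% s.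
move=> lt_x lt_r En Ek.
have [le_xr|lt_rx] := leqP x r.
  have [le|gt] := leqP (x + y) ((r + l) %/ 2).
    by exists x, y, 0%R; split; lia.
  by exists (x%:Z - r%:Z)%R, (y%:Z - l%:Z)%R, 1%R; split; lia.
have [le|gt] := leqP (s - x + y.+1) ((s - r + l).+1 %/ 2).
  by exists (x%:Z - s%:Z)%R, (y%:Z + 1)%R, 0%R; split; lia.
by exists (x%:Z - r%:Z)%R, (y%:Z - l%:Z)%R, 1%R; split; lia.
Qed.

(** With n = l s + r, the first half is small enough since 2 l - 3 <= (l - 1) s,
    and r < s, and the second one as soon as 4 <= (l - 2)(s - 2) + 3 r.  When
    this last inequality fails, rounding down still saves the bound for every
    pair (n, s) outside the exceptions. *)
Lemma corners_le_quarter :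
  s != 2 -> n != s.*2.+1 -> (n, s) \notin [:: (9, 3); (12, 3); (12, 4)] ->
  maxn ((n %% s + n %/ s) %/ 2) ((s - n %% s + n %/ s).+1 %/ 2) <= (n + 2) %/ 4.
Proof.
rewrite !inE !xpair_eqE => s_neq2 n_neq exc; have s_gt0 : 0 < s by lia.
have := divn_eq n s; have := ltn_pmod n s_gt0.
have : 2 <= n %/ s by rewrite leq_divRL //; lia.
set l := n %/ s; set r := n %% s => l_ge2 lt_r En.
have le1 : r + 2 * l <= l * s + 2 by nia.
suff : (s - r + l).+1 %/ 2 <= (n + 2) %/ 4 by lia.
have [r_ge2|r_lt2] := leqP 2 r.
  suff : 2 * s + 2 * l <= l * s + 3 * r by lia.
  by nia.
(* For r < 2, l = 2 would mean n = 2 s or n = 2 s + 1. *)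
have l_ge3 : 3 <= l by nia.
have [rE|rE] : r = 1 \/ r = 0 by lia.
  suff : 2 * s + 2 * l <= l * s + 3 by lia.
  by nia.
have [big|small] := boolP ((6 <= s) || (6 <= l)).
  suff : 2 * s + 2 * l <= l * s by lia.
  by nia.
have [lE|[lE|lE]] : l = 3 \/ l = 4 \/ l = 5 by lia.
  all: have [sE|[sE|sE]] : s = 3 \/ s = 4 \/ s = 5 by lia.
  all: by move: exc; rewrite En lE sE rE.
Qed.

Lemma represents_quarter k : k <= n %/ 2 -> represents ((n + 2) %/ 4) k.
Proof.
move=> le_k; have lt_kn : k < n by lia.
(* For s = 2, use k / 2 steps of length 2 and the parity of k. *)
have [sE|s_neq2] := eqVneq s 2.
  by exists (k %% 2), (k %/ 2), 0%R; split; lia.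
(* For n = 2 s + 1, k <= s, and the vectors (k, 0) and (k - s, 1) have total
   length s + 1. *)
have [nE|n_neq] := eqVneq n s.*2.+1.
  have [le|gt] := leqP k ((n + 2) %/ 4).
    by exists k, 0%R, 0%R; split; lia.
  by exists (k%:Z - s%:Z)%R, 1%R, 0%R; split; lia.
have [|generic] := boolP ((n, s) \in [:: (9, 3); (12, 3); (12, 4)]); last first.
  exact: represents_le (corners_le_quarter s_neq2 n_neq generic)
                       (represents_corners lt_kn).
rewrite !inE !xpair_eqE => exc.
(* In these three cases each k <= n / 2 has a small enough x + y. *)
exists (k %% s), (k %/ s), 0%R; split; last by have := divn_eq k s; lia.
by move: exc => /or3P[] /andP[/eqP nE /eqP sE]; subst n s; lia.
Qed.

End Circulant.

Theorem theorem3p16 (n s : nat) (hn : 5 <= n) (hs2 : 2 <= s)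
    (hs : s <= (n - 1) %/ 2) :
  ((diam (circulant n s))%:Z <=
   Num.min
     (Num.min
        (Num.max (Num.max ((n %/ s)%N%:Z + 1)
                          (n%:Z - (n %/ s)%N%:Z * s%:Z - 2))
                 (((n %/ s)%N%:Z + 1) * s%:Z - n%:Z - 1))
        ((n + 2) %/ 4)%N%:Z)
     (n %/ 2 %/ s + uphalf s)%N%:Z)%R.
Proof.
have corner := diam_represents hs2 hs (fun k (le : k <= n %/ 2) =>
  represents_corners hs2 hs (k := k) ltac:(lia)).
have quarter := diam_represents hs2 hs (represents_quarter hs2 hs).
have nearest := diam_represents hs2 hs (represents_nearest hs2 hs).
have En := divn_eq n s; have lt_r : n %% s < s by rewrite ltn_mod; lia.
rewrite !le_min !lez_nat quarter nearest !andbT !le_max.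
by set l := n %/ s in En corner *; set r := n %% s in En lt_r corner; lia.
Qed.
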